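(* Let $\mathcal{A}$ be a finite alphabet, let $\mathcal{F}\subseteq\mathcal{A}^+_{\mathbb{Z}}$ be a set of connected patterns, and let $\beta$ be a positive real number such that $$|\mathcal{A}|-\sum_{f\in\mathcal{F}}\beta^{1-|f|}\ge\beta$$ (in particular the sum converges). Then $\alpha(X_{\mathcal{F}})\ge\beta$ and $h(X_{\mathcal{F}})\ge\log\beta$.
   Context: A pattern over $\mathbb{Z}$ is an element $p\in\mathcal{A}^S$ where $S=\operatorname{supp}(p)\subseteq\mathbb{Z}$ is non-empty and finite; its size is $|p|=|S|$; $\mathcal{A}^+_{\mathbb{Z}}$ is the set of all patterns. A pattern is connected if its support is an interval $\{i,i+1,\ldots,j\}$ with $i\le j$. A pattern $f$ appears in $x\in\mathcal{A}^{\mathbb{Z}}$ if there is $g\in\mathbb{Z}$ with $x(g+s)=f(s)$ for all $s\in\operatorname{supp}(f)$. $X_{\mathcal{F}}$ is the set of $x\in\mathcal{A}^{\mathbb{Z}}$ in which no $f\in\mathcal{F}$ appears. For finite $S\subseteq\mathbb{Z}$, $\mathcal{G}_{\mathcal{F}}^{(S)}$ is the set of $p\in\mathcal{A}^S$ that appear in some $x\in X_{\mathcal{F}}$. The growth is $\alpha(X_{\mathcal{F}})=\lim_{n\to\infty}\big(\min_{S\subseteq\mathbb{Z},|S|=n}|\mathcal{G}_{\mathcal{F}}^{(S)}|\big)^{1/n}$ (minimum over all finite sets of size $n$, not only intervals; the limit exists), and the topological entropy is $h(X_{\mathcal{F}})=\lim_{n\to\infty}\frac{\log|\mathcal{G}_{\mathcal{F}}^{(S_n)}|}{|S_n|}$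 with $S_n=\{-n,\ldots,n\}$. *)

(* Defs.v *)
From HB Require Import structures.
From mathcomp Require Import all_boot all_order all_algebra finmap.
From mathcomp Require Import all_classical all_reals all_analysis.

Set Implicit Arguments.
Unset Strict Implicit.
Unset Printing Implicit Defensive.

Import Order.TTheory GRing.Theory Num.Theory numFieldNormedType.Exports.

Local Open Scope classical_set_scope.
Local Open Scope ring_scope.

(* {fmap int -> A} is the disjoint union, over finite S, of the A^S. *)
Record pattern (A : finType) := Pattern {
  pattern_fmap : {fmap int -> A};
  pattern_supp_neq0 : domf pattern_fmap != fset0 }.

HB.instance Definition _ (A : finType) :=
  [isSub for @pattern_fmap A].
HB.instance Definition _ (A : finType) := [Choice of pattern A by <:].

Definition supp (A : finType) (p : pattern A) : {fset int} := domf (pattern_fmap p).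

Definition psize (A : finType) (p : pattern A) : nat := #|` supp p|.

Definition connected_pattern (A : finType) (p : pattern A) : Prop :=
  exists i j : int, i <= j /\ forall k : int, (k \in supp p) = (i <= k <= j).

Definition appears (A : finType) (f : {fmap int -> A}) (x : int -> A) : Prop :=
  exists g : int, forall s : domf f, x (g + val s) = f s.

Definition subshift (A : finType) (F : set (pattern A)) : set (int -> A) :=
  [set x | forall f, F f -> ~ appears (pattern_fmap f) x].

Definition globally_admissible (A : finType) (F : set (pattern A))
    (S : {fset int}) : {set {ffun S -> A}} :=
  [set p : {ffun S -> A} |
    `[< exists2 x, subshift F x & appears (FinMap p) x >]].

Lemma min_admissible_subproof (A : finType) (F : set (pattern A)) (n : nat) :
  exists m : nat, `[< exists2 S : {fset int},
    #|` S| = n & #|globally_admissible F S| = m >].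
Proof.
pose S : {fset int} := [fset i%:Z | i in iota 0 n]%fset.
exists #|globally_admissible F S|; apply/asboolP; exists S => //.
rewrite card_imfset => [|i j []//].
rewrite -[RHS](size_iota 0 n); apply/perm_size/uniq_perm.
- exact: enum_finmem_uniq.
- exact: iota_uniq.
- exact: enum_finmemE.
Qed.

Definition min_admissible (A : finType) (F : set (pattern A)) (n : nat) : nat :=
  ex_minn (min_admissible_subproof F n).

Definition growth_seq (R : realType) (A : finType) (F : set (pattern A))
    (n : nat) : R :=
  (min_admissible F n)%:R `^ n%:R^-1.

Definition growth (R : realType) (A : finType) (F : set (pattern A)) : R :=
  limn (growth_seq R F).

Definition centered_interval (n : nat) : {fset int} :=
  [fset i%:Z - n%:Z | i in iota 0 (2 * n).+1]%fset.

(* Extended-real valued, so that the entropy of the empty subshift is -oo. *)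
Definition entropy_seq (R : realType) (A : finType) (F : set (pattern A))
    (n : nat) : \bar R :=
  (lne (#|globally_admissible F (centered_interval n)|%:R)%:E
   * ((#|` centered_interval n|%:R)^-1)%:E)%E.

Definition entropy (R : realType) (A : finType) (F : set (pattern A)) : \bar R :=
  limn (entropy_seq R F).

(* Main.v *)
Require Import Defs.
From mathcomp Require Import all_boot all_order all_algebra finmap.
From mathcomp Require Import all_classical all_reals all_analysis.
From mathcomp Require Import zify lra.

Set Implicit Arguments.
Unset Strict Implicit.
Unset Printing Implicit Defensive.

Import Order.TTheory GRing.Theory Num.Theory numFieldNormedType.Exports.

Local Open Scope classical_set_scope.
Local Open Scope ring_scope.

(* Let L_n be the set of words of length n avoiding the words of F.  Extending a
   word of L_n by one letter fails only if the result ends with a forbidden word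
   u, whose removal leaves a word of L_(n+1-|u|); by induction this gives
   |L_(n+1)| >= beta |L_n|, hence |L_n| >= beta^n.

   For a finite set S of positions which need not be an interval, the translates
   of S cover every position of {0..N-1} exactly |S| times, so by Shearer's
   inequality |L_N|^|S| is at most the product over these translates S' of the
   number of restrictions of L_N to S'.  By compactness, all but boundedly many
   factors count only restrictions of elements of X_F, so each of them is at
   most G = |G_F^(S)|.  Thus beta^(N|S|) <= C G^N for all N, that is
   G >= beta^|S|.  Both limits exist by Fekete's lemma. *)

(** * Hölder's and Shearer's inequalities *)

(* Hoelder's inequality for [#|K|] functions, with the roots cleared. *)
Lemma prod_sum_ge_sum_exp (R : realType) (A J : finType) (K : {pred J})
    (C : R) (x : J -> A -> R) (y : A -> R) :
    (0 < #|K|)%N -> 0 <= C -> (forall j a, 0 <= x j a) -> (forall a, 0 <= y a) ->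
    (forall a, y a ^+ #|K| <= C * \prod_(j in K) x j a) ->
  (\sum_a y a) ^+ #|K| <= C * \prod_(j in K) \sum_a x j a.
Proof.
move=> K0 C0 x0 y0 yx; set k := #|K|; pose X j := \sum_a x j a.
have X0 j : 0 <= X j by apply: sumr_ge0.
have rhs0 : 0 <= C * \prod_(j in K) X j by rewrite mulr_ge0// prodr_ge0.
(* If some [X j] vanishes, so does every [y a]; otherwise one can normalise by the [X j]. *)
have [/existsP[j /andP[jK /eqP Xj0]]|] := boolP [exists j in K, X j == 0].
  rewrite big1 ?expr0n -?lt0n ?K0// => [|a _]; first by rewrite gtn_eqF.
  have xj0 : x j a = 0.
    by apply: (psumr_eq0P _ Xj0) => // b _.
  have := yx a; rewrite (bigD1 j)//= xj0 mul0r mulr0 => ya.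
  have : y a ^+ k == 0 by rewrite eq_le ya exprn_ge0.
  by rewrite expf_eq0 K0 => /eqP.
rewrite negb_exists => /forallP XN.
have Xn0 j : j \in K -> X j != 0 by move=> jK; have := XN j; rewrite jK.
(* With [D] the [k]-th root of the right-hand side, AM-GM for the normalised factors [x j a / X j]
   gives [y a <= D * z a], and the weights [z a] sum to 1. *)
pose D := (C * \prod_(j in K) X j) `^ k%:R^-1.
have D0 : 0 <= D by exact: powR_ge0.
have Dk : D ^+ k = C * \prod_(j in K) X j.
  by rewrite -powR_mulrn// -powRrM mulVf ?powRr1// pnatr_eq0 -lt0n.
pose z a := (\sum_(j in K) x j a / X j) / k%:R.
have z0 a : 0 <= z a.
  by rewrite divr_ge0// sumr_ge0// => j _; rewrite divr_ge0.
have yz a : y a <= D * z a.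
  have Dz0 : 0 <= D * z a by rewrite mulr_ge0.
  rewrite -(ler_pXn2r K0) ?nnegrE//.
  rewrite exprMn.
  apply: (le_trans (yx a)).
  have -> : C * \prod_(j in K) x j a = D ^+ k * \prod_(j in K) (x j a / X j).
    rewrite Dk -mulrA -big_split/=; congr (C * _); apply: eq_bigr => j jK.
    by rewrite mulrC divfK ?Xn0.
  apply: ler_wpM2l; first by rewrite exprn_ge0.
  by have [] := @leif_AGM _ _ K (fun j => x j a / X j) (fun j _ => divr_ge0 (x0 j a) (X0 j)).
have z1 : \sum_a z a = 1.
  rewrite -mulr_suml exchange_big/= (eq_bigr (fun=> 1)) => [|j jK].
    by rewrite sumr_const divff// pnatr_eq0 -lt0n.
  by rewrite -mulr_suml divff ?Xn0.
rewrite -Dk; apply: lerXn2r; rewrite ?nnegrE ?sumr_ge0//.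
by rewrite (le_trans (ler_sum _ (fun a _ => yz a)))// -mulr_sumr z1 mulr1.
Qed.

(** Hidden letters become [None] instead of being deleted, so all projections keep length [n] and
    can be peeled letter by letter. *)
Definition masked (A : finType) (n : nat) (T : pred nat) (w : n.-tuple A) :
    n.-tuple (option A) :=
  [tuple if T i then Some (tnth w i) else None | i < n].

Lemma masked_cons (A : finType) (T : pred nat) (n : nat) (a : A) (w : n.-tuple A) :
  masked T [tuple of a :: w] =
  [tuple of (if T 0 then Some a else None) :: masked (fun i => T i.+1) w].
Proof.
apply: eq_from_tnth => i; case: (unliftP ord0 i) => [j ->|->].
  by rewrite tnth_mktuple !tnthS tnth_mktuple.
by rewrite tnth_mktuple !tnth0.
Qed.

(** Induction on [n], splitting [L] by its first letter into the [La a]. A factor whose mask hides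
    position 0 bounds each [x j a] separately; each of the [k] factors that show it bounds the sum
    over [a]. Hölder's inequality combines the [k] sums. *)
Lemma shearer (R : realType) (A J : finType) (k n : nat) (T : J -> pred nat)
    (L : {set n.-tuple A}) :
    (0 < k)%N -> (forall i, (i < n)%N -> #|[pred j | T j i]| = k) ->
  #|L|%:R ^+ k <= \prod_j #|masked (T j) @: L|%:R :> R.
Proof.
move=> k0; elim: n T L => [|n IHn] T L Tk.
  have [->|[w wL]] := set_0Vmem L.
    by rewrite cards0 expr0n gtn_eqF// prodr_ge0.
  have -> : #|L| = 1.
    apply/eqP; rewrite eqn_leq card_gt0; apply/andP; split.
      by rewrite (leq_trans (max_card _))// card_tuple.
    by apply/set0Pn; exists w.
  rewrite expr1n -natr_prod ler1n prodn_gt0// => j.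
  by rewrite card_gt0; apply/set0Pn; exists (masked (T j) w); rewrite imset_f.
pose La a := [set w : n.-tuple A | [tuple of a :: w] \in L]%SET.
have cons_inj (B : finType) (b : B) :
    injective (fun w : n.-tuple B => [tuple of b :: w]).
  by move=> u v /(congr1 val)[] /val_inj.
have cardE (B : finType) (V : {set n.+1.-tuple B}) :
    #|V| = (\sum_b #|[set w : n.-tuple B | [tuple of b :: w] \in V]%SET|)%N.
  rewrite -sum1_card (partition_big (@thead _ _) predT)//=.
  apply: eq_bigr => b _; rewrite sum1dep_card -(card_imset _ (cons_inj _ b)).
  apply: eq_card => v; rewrite !inE; apply/andP/imsetP => [[vV /eqP vb]|[w]].
    have vE : v = [tuple of b :: [tuple of behead v]].
      by apply: val_inj; rewrite [in LHS](tuple_eta v) vb.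
    by exists [tuple of behead v] => //; move: vV; rewrite inE [X in X \in V -> _]vE.
  by rewrite inE => wV ->; rewrite theadE.
have projS (j : J) (a : A) (w : n.-tuple A) : w \in La a ->
    [tuple of (if T j 0%N then Some a else None) :: masked (fun i => T j i.+1) w]
      \in masked (T j) @: L.
  by rewrite inE => wL; rewrite -masked_cons imset_f.
pose x j a : R := #|masked (fun i => T j i.+1) @: La a|%:R.
have xC j a : x j a <= #|masked (T j) @: L|%:R.
  rewrite ler_nat -(card_imset _ (cons_inj _ (if T j 0%N then Some a else None))).
  apply: subset_leq_card; apply/fintype.subsetP => _ /imsetP[_ /imsetP[w wL ->] ->].
  exact: projS.
(* As position 0 is visible, the images of different [La a] are told apart by their first symbol
   [Some a]. *)
have xS j : T j 0%N -> \sum_a x j a <= #|masked (T j) @: L|%:R.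
  move=> Tj; rewrite -natr_sum ler_nat (cardE _ (_ @: L)).
  rewrite (bigD1 None)//= (reindex_omap Some id) => [|[]//].
  rewrite (leq_trans _ (leq_addl _ _))// [X in (_ <= X)%N](eq_bigl predT); last first.
    by move=> a /=; rewrite eqxx.
  apply: leq_sum => a _; apply: subset_leq_card.
  apply/fintype.subsetP => _ /imsetP[w wL ->]; rewrite inE.
  by have := projS j a w wL; rewrite Tj.
pose K : {pred J} := [pred j | T j 0%N]; have cK : #|K| = k by rewrite Tk.
rewrite (bigID (mem K))/= mulrC cardE natr_sum -cK.
set C := \prod_(j | j \notin K) _.
have C0 : 0 <= C by apply: prodr_ge0.
have K0 : (0 < #|K|)%N by rewrite cK.
apply: (le_trans (@prod_sum_ge_sum_exp R A J K C x (fun a => #|La a|%:R) K0 C0 _ _ _)) => //.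
  move=> a; rewrite cK.
  apply: (le_trans (IHn (fun j i => T j i.+1) (La a) _)) => [i ni|].
    exact: (Tk i.+1).
  rewrite (bigID (mem K))/= mulrC ler_wpM2r ?prodr_ge0//.
  by apply: ler_prod => j _; rewrite ler0n xC.
apply: ler_wpM2l => //; apply: ler_prod => j jK.
by rewrite sumr_ge0// xS.
Qed.

(** * Growth of the number of words avoiding forbidden words *)

Definition avoids (A : finType) (W : set (seq A)) (w : seq A) : bool :=
  `[< forall u, W u -> ~~ infix u w >].

Definition language (A : finType) (W : set (seq A)) (n : nat) : {set n.-tuple A} :=
  [set w : n.-tuple A | avoids W w]%SET.

Definition forbidden (A : finType) (W : set (seq A)) (n : nat) : {set n.-tuple A} :=
  [set u : n.-tuple A | `[< W u >]]%SET.

(* If [w] avoids [W] but [w a] does not, then [w a = w' u] with [u] in [W]. *)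
Lemma card_language_ext (A : finType) (W : set (seq A)) (n : nat) :
    ~ W [::] ->
  (#|A| * #|language W n| <= #|language W n.+1| +
    \sum_(m < n.+1) #|language W (n - m)| * #|forbidden W m.+1|)%N.
Proof.
move=> W0.
have eqn m : (m < n.+1)%N -> (n - m + m.+1 = n.+1)%N by lia.
(* Words of length [n.+1] ending in a forbidden word of length [m.+1] after an avoiding word;
   [tcast] only adjusts the length. *)
pose bad (m : 'I_n.+1) := [set tcast (eqn m (ltn_ord m)) [tuple of wu.1 ++ wu.2]
  | wu : (n - m).-tuple A * m.+1.-tuple A in finset.setX (language W (n - m)) (forbidden W m.+1)]%SET.
pose ext := [set [tuple of rcons wa.1 wa.2]
  | wa : n.-tuple A * A in finset.setX (language W n) [set: A]]%SET.
have -> : (#|A| * #|language W n| = #|ext|)%N.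
  rewrite card_imset ?cardsX ?cardsT 1?mulnC// => -[w a] [w' a'] /= /(congr1 val)/=.
  by move=> /rcons_inj[/val_inj -> ->].
apply: (@leq_trans #|language W n.+1 :|: \bigcup_(m < n.+1) bad m|%SET); last first.
  rewrite (leq_trans (leq_card_setU _ _))// leq_add2l.
  apply: (big_ind2 (fun (X : {set n.+1.-tuple A}) k => #|X| <= k)%N).
  - by rewrite cards0.
  - move=> X k Y l Xk Yl.
    by rewrite (leq_trans (leq_card_setU _ _))// leq_add.
  - by move=> m _; rewrite (leq_trans (leq_imset_card _ _))// cardsX.
apply: subset_leq_card; apply/fintype.subsetP => _ /imsetP[[w a] /finset.setXP[/= wL _] ->].
rewrite finset.inE; case: (boolP (_ \in language _ _)) => //=.
rewrite finset.inE => /asboolPn/existsNP[u /not_implyP[Wu /negP]].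
rewrite negbK infix_rconsl => /orP[|uw]; last first.
  by move: wL; rewrite finset.inE => /asboolP/(_ u Wu); rewrite uw.
move=> /suffixP[w' wE].
have u0 : (0 < size u)%N by case: u Wu {wE} => // /W0.
have sz : (size w' + size u = n.+1)%N by rewrite -size_cat -wE size_rcons size_tuple.
have mn : ((size u).-1 < n.+1)%N by lia.
have sw' : size w' == (n - (size u).-1)%N by lia.
have su : size u == (size u).-1.+1 by lia.
apply/bigcupP; exists (Ordinal mn) => //; apply/imsetP.
exists (Tuple sw', Tuple su); last by apply: val_inj; rewrite /= val_tcast.
apply/finset.setXP; split; rewrite finset.inE/=; last exact/asboolP.
apply/asboolP => v Wv; move: wL; rewrite finset.inE => /asboolP/(_ v Wv).
apply: contraNN => vw'.
(* Dropping the last letter of [u] shows that [w'] is a prefix of [w], so it inherits avoidance. *)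
have [u' [a' uE]] : exists u' a', u = rcons u' a'.
  by case/lastP: u u0 {wE Wu sz mn sw' su} => // u' a' _; exists u', a'.
move: wE; rewrite uE -rcons_cat => /rcons_inj[-> _].
exact: infix_catr.
Qed.

Lemma language_growth (R : realType) (A : finType) (W : set (seq A)) (beta : R) :
    0 < beta -> ~ W [::] ->
    (forall n, \sum_(m < n) #|forbidden W m.+1|%:R / beta ^+ m <= #|A|%:R - beta) ->
  forall n, beta ^+ n <= #|language W n|%:R.
Proof.
move=> b0 W0 Wsum.
suff step n : beta * #|language W n|%:R <= #|language W n.+1|%:R :> R.
  elim=> [|n IHn]; last by rewrite exprS (le_trans _ (step n))// ler_pM2l.
  rewrite expr0 ler1n card_gt0; apply/set0Pn; exists [tuple].
  rewrite finset.inE; apply/asboolP => u Wu; apply/negP; rewrite infixs0.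
  by move=> /eqP u0; apply: W0; rewrite -u0.
elim/ltn_ind: n => n IHn.
(* The inductive ratio bound, chained [m] times, so that the loss in [card_language_ext] is at most
   [|A| - beta] times [#|language W n|]. *)
have IH m : (m <= n)%N -> #|language W (n - m)|%:R <= #|language W n|%:R / beta ^+ m :> R.
  elim: m => [_|m IHm mn]; first by rewrite subn0 expr0 divr1.
  rewrite exprS invfM mulrCA mulrC ler_pdivlMr// mulrC.
  rewrite (le_trans _ (IHm (ltnW mn)))//.
  by rewrite -[in leRHS](subnSK mn) IHn//; lia.
have L0 : 0 <= #|language W n|%:R :> R by [].
have ext : #|A|%:R * #|language W n|%:R <= #|language W n.+1|%:R +
    (\sum_(m < n.+1) #|forbidden W m.+1|%:R / beta ^+ m) * #|language W n|%:R :> R.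
  rewrite mulr_suml -natrM.
  apply: (@le_trans _ _ (#|language W n.+1| +
    \sum_(m < n.+1) #|language W (n - m)| * #|forbidden W m.+1|)%:R).
    by rewrite ler_nat card_language_ext.
  rewrite natrD natr_sum lerD2l; apply: ler_sum => m _.
  by rewrite natrM mulrC mulrAC -mulrA ler_wpM2l// IH// -ltnS.
have := ler_wpM2r L0 (Wsum n.+1); rewrite mulrBl; lra.
Qed.

(** * From connected patterns to forbidden words *)

(** Letters are read by increasing position, so translates of a pattern share one word. *)
Definition pattern_word (A : finType) (f : pattern A) : seq A :=
  pmap (fun k => (pattern_fmap f).[? k]%fmap) (sort <=%O (supp f)).

Lemma size_pattern_word (A : finType) (f : pattern A) :
  size (pattern_word f) = psize f.
Proof.
rewrite size_pmap (@eq_in_count _ _ predT) ?count_predT ?size_sort// => k.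
by rewrite mem_sort => kf /=; rewrite in_fnd.
Qed.

Lemma psize_gt0 (A : finType) (f : pattern A) : (0 < psize f)%N.
Proof. by rewrite cardfs_gt0 pattern_supp_neq0. Qed.

Lemma pattern_word_appears (A : finType) (f : pattern A) (x : int -> A) :
    connected_pattern f -> appears (pattern_fmap f) x ->
  exists g : int, pattern_word f = [seq x (g + m%:Z) | m <- iota 0 (psize f)].
Proof.
move=> [i [j [ij fij]]] [g gx]; exists (g + i).
have suppE : sort <=%O (supp f) = [seq i + m%:Z | m <- iota 0 `|j - i|.+1].
  apply: lt_sorted_eq.
  - by rewrite sort_lt_sorted fset_uniq.
  - rewrite sorted_map; apply: sub_sorted (iota_ltn_sorted _ _) => a b /=.
    by rewrite ltrD2l ltz_nat.
  - move=> k; rewrite mem_sort fij; apply/idP/mapP => [kij|[m]].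
      by exists `|k - i|%N; rewrite ?mem_iota; lia.
    by rewrite mem_iota; lia.
have -> : psize f = `|j - i|.+1.
  by rewrite -[LHS]/(size (supp f)) -(size_sort <=%O) suppE size_map size_iota.
have pmapE s : {subset s <= supp f} ->
    pmap (fun k => (pattern_fmap f).[? k]%fmap) s = [seq x (g + k) | k <- s].
  elim: s => //= k s IHs ks.
  have kf : k \in supp f by rewrite ks ?mem_head.
  rewrite in_fnd /= -(gx [` kf]%fset) IHs// => l ls.
  by rewrite ks// inE ls orbT.
rewrite /pattern_word pmapE => [|k]; last by rewrite mem_sort.
by rewrite suppE -map_comp; apply: eq_map => m /=; rewrite addrA.
Qed.

(** Choosing one pattern of [F] per forbidden word is injective, and a word of length [m.+1] has
    weight [beta ^- m]; the left side is thus a finite subsum of the sum over [F]. *)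
Lemma sum_forbidden_le (R : realType) (A : finType) (F : set (pattern A))
    (beta : R) : 0 < beta ->
    (beta%:E <= (#|A|%:R)%:E
      - \esum_(f in F) (beta ^ (1 - (psize f)%:Z))%:E)%E ->
  forall n, \sum_(m < n) #|forbidden (@pattern_word A @` F) m.+1|%:R / beta ^+ m
    <= #|A|%:R - beta.
Proof.
move=> b0 hsum n; set W := @pattern_word A @` F.
(* The sum over [F] is finite: an infinite one would make the right side of [hsum] equal to
   [-oo]. *)
suff : ((\sum_(m < n) #|forbidden W m.+1|%:R / beta ^+ m)%:E <=
    \esum_(f in F) (beta ^ (1 - (psize f)%:Z))%:E)%E.
  move: hsum; case: (\esum_(f in F) _)%E => [s| |]//=.
  by rewrite -EFinB !lee_fin; lra.
have [F0|/set0P[f0 Ff0]] := eqVneq F set0.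
  rewrite big1 ?F0 ?esum_set0// => m _.
  rewrite (_ : forbidden _ _ = finset.set0) ?cards0 ?mul0r//.
  by apply/setP => u; rewrite !finset.inE; apply/asboolPn => -[f]; rewrite F0.
have /boolp.choice[pat patP] :
    forall u, exists f, W u -> F f /\ pattern_word f = u.
  move=> u.
  have [[f Ff fu]|nWu] := pselect (W u); first by exists f.
  by exists f0.
pose D := [pred t : {m : 'I_n & m.+1.-tuple A} | tagged t \in forbidden W (tag t).+1].
pose word (t : {m : 'I_n & m.+1.-tuple A}) : seq A := tagged t.
have DW t : D t -> W (word t) by rewrite /D/= finset.inE => /asboolP.
have size_word t : size (word t) = (tag t).+1 by rewrite size_tuple.
have word_inj : injective word.
  move=> [m u] [m' u'] uu'.
  have mm' : m = m' by apply/val_inj/succn_inj; rewrite -[LHS](size_tuple u) -[RHS](size_tuple u') [tval u]uu'.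
  by case: _ / mm' in u' uu' *; congr existT; apply: val_inj.
have pat_uniq : uniq [seq pat (word t) | t <- enum D].
  rewrite map_inj_in_uniq ?enum_uniq// => t t'; rewrite !mem_enum => Dt Dt' ptt'.
  by apply: word_inj; rewrite -(patP _ (DW t Dt)).2 ptt' (patP _ (DW t' Dt')).2.
apply: esum_ge; exists [set` [seq pat (word t) | t <- enum D]].
  split; first exact: finite_seq.
  by move=> _ /= /mapP[t + ->]; rewrite mem_enum => /DW/patP[].
rewrite -fsbig_seq// big_map big_enum/=.
rewrite (eq_bigr (fun t : {m : 'I_n & m.+1.-tuple A} => (beta ^- (tag t))%:E)) => [|t Dt]; last first.
  rewrite -size_pattern_word (patP _ (DW t Dt)).2 size_word.
  by congr (_%:E); rewrite exprnN; congr (_ ^ _); lia.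
rewrite sumEFin lee_fin.
rewrite -(@sig_big_dep _ _ _ 'I_n (fun m : 'I_n => (m.+1.-tuple A : finType)) predT
  (fun m u => u \in forbidden W m.+1) (fun m _ => beta ^- m))/=.
apply: ler_sum => m _.
by rewrite sumr_const mulrC -[leRHS]mulr_natr.
Qed.

(** * Traces of a subshift on finite families of positions *)

(** Positions form a family [s], not a set: translating keeps the index type, and joining two
    families takes the sum of index types. *)
Definition traces (A I : finType) (X : set (int -> A)) (s : I -> int) :
    {set {ffun I -> A}} :=
  [set p : {ffun I -> A} | `[< exists2 x, X x & forall i, x (s i) = p i >]]%SET.

Lemma traces_in (A I : finType) (X : set (int -> A)) (s : I -> int)
    (p : {ffun I -> A}) :
  p \in traces X s <-> exists2 x, X x & forall i, x (s i) = p i.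
Proof. by rewrite finset.inE; split=> [/asboolP|?]; [|apply/asboolP]. Qed.

Lemma card_traces_le (A I J : finType) (X : set (int -> A)) (s : I -> int)
    (r : J -> int) :
  (forall i, exists j, r j = s i) -> (#|traces X s| <= #|traces X r|)%N.
Proof.
move=> /boolp.choice[h hP].
rewrite (leq_trans _ (leq_imset_card (fun q : {ffun J -> A} => [ffun i => q (h i)]) _))//.
apply/subset_leq_card/fintype.subsetP => p /traces_in[x Xx xp]; apply/imsetP.
exists [ffun j => x (r j)]; first by apply/traces_in; exists x => // j; rewrite ffunE.
by apply/ffunP => i; rewrite !ffunE hP xp.
Qed.

Lemma card_traces_sum (A I J : finType) (X : set (int -> A)) (s : I -> int)
    (r : J -> int) :
  (#|traces X (fun k : I + J => match k with inl i => s i | inr j => r j end)|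
    <= #|traces X s| * #|traces X r|)%N.
Proof.
rewrite -cardsX.
rewrite (leq_trans _ (leq_imset_card (fun pq : {ffun I -> A} * {ffun J -> A} =>
  [ffun k => match k with inl i => pq.1 i | inr j => pq.2 j end]) _))//.
apply/subset_leq_card/fintype.subsetP => p /traces_in[x Xx xp]; apply/imsetP.
exists ([ffun i => x (s i)], [ffun j => x (r j)]).
  by apply/finset.setXP; split; apply/traces_in; exists x => // k; rewrite ffunE.
by apply/ffunP => -[i|j]; rewrite -xp !ffunE /= ?ffunE.
Qed.

Lemma subshift_shift (A : finType) (F : set (pattern A)) (g : int) (x : int -> A) :
  subshift F x -> subshift F (fun k => x (g + k)).
Proof.
move=> Fx f Ff [h fh]; apply: (Fx f Ff); exists (g + h) => s.
by rewrite -addrA fh.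
Qed.

Lemma traces_shift (A I : finType) (F : set (pattern A)) (g : int) (s : I -> int) :
  traces (subshift F) (fun i => g + s i) = traces (subshift F) s.
Proof.
apply/setP => p; apply/idP/idP => /traces_in[x Fx xp]; apply/traces_in.
  by exists (fun k => x (g + k)) => //; exact: subshift_shift.
exists (fun k => x (- g + k)) => [|i]; first exact: subshift_shift.
by rewrite addKr.
Qed.

(** Shift invariance absorbs the translation allowed by [appears]. *)
Lemma globally_admissibleE (A : finType) (F : set (pattern A)) (S : {fset int}) :
  globally_admissible F S = traces (subshift F) (val : S -> int).
Proof.
apply/setP => p; rewrite !finset.inE; apply/asboolP/asboolP => -[x Fx].
  move=> [g xp]; exists (fun k => x (g + k)); first exact: subshift_shift.
  exact: xp.
by move=> xp; exists x => //; exists 0 => s; rewrite add0r; exact: xp.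
Qed.

(** * Compactness *)

(** For an ultrafilter [U] finer than [\oo], [x k] is the letter that [y B k] equals for [U]-almost
    all [B]; it exists because [A] is finite. Finitely many such conditions hold together for
    arbitrarily large [B]. *)
Lemma exists_cluster_sequence (A : finType) (y : nat -> int -> A) :
  exists x : int -> A, forall (E : seq int) (N : nat),
    exists2 B, (N <= B)%N & {in E, y B =1 x}.
Proof.
have [U [UU ooU]] := @ultraFilterLemma nat \oo _.
have /boolp.choice[x xP] : forall k, exists a, U [set B | y B k = a].
  move=> k; apply: contrapT => /forallNP nU.
  have : U [set B | forall a, y B k <> a].
    apply: filter_forall => a.
    by have [/nU|] := in_ultra_setVsetC [set B | y B k = a] UU.
  by move=> /filter_ex[B /(_ (y B k))].
exists x => E N.
have UE : U [set B | {in E, y B =1 x}].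
  elim: E => [|k E IHE]; first by apply: filterS filterT => B _ k.
  apply: filterS (filterI (xP k) IHE) => B [/= yk yE] l.
  by rewrite inE => /predU1P[->|/yE].
have UN : U [set B | (N <= B)%N] by apply: ooU; exact: nbhs_infty_ge.
have /filter_ex[B []] : U ([set B | (N <= B)%N] `&` [set B | {in E, y B =1 x}]).
  exact: filterI.
by exists B.
Qed.

(** Otherwise, for every [B], some avoiding word has a bad window starting at distance at least [B]
    from both ends. Recentred at these windows, the words cluster at a point of the subshift, whose
    trace equals one of the bad windows. *)
Lemma window_traces (A I : finType) (F : set (pattern A)) (a0 : A) (s : I -> nat) :
    (forall f, F f -> connected_pattern f) ->
  exists B, forall (w : seq A) (u : nat), avoids (@pattern_word A @` F) w ->
    (B <= u)%N -> (u + B <= size w)%N ->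
    [ffun i => nth a0 w (u + s i)] \in traces (subshift F) (fun i => (s i)%:Z).
Proof.
move=> hF; apply: contrapT => /forallNP nB.
have /boolp.choice[wu wuP] : forall B, exists wu : seq A * nat,
    [/\ avoids (@pattern_word A @` F) wu.1, (B <= wu.2)%N,
        (wu.2 + B <= size wu.1)%N &
        [ffun i => nth a0 wu.1 (wu.2 + s i)]
          \notin traces (subshift F) (fun i => (s i)%:Z)].
  move=> B; have /existsNP[w /existsNP[u]] := nB B.
  move=> /not_implyP[w1 /not_implyP[w2 /not_implyP[w3 /negP w4]]].
  by exists (w, u).
(* Outside the word [absz] and [a0] give arbitrary values; only coordinates inside it are compared
   below. *)
have [x xP] := exists_cluster_sequence
  (fun B k => nth a0 (wu B).1 (absz ((wu B).2%:Z + k)%R)).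
have Fx : subshift F x.
  move=> f Ff fx; have [g fg] := pattern_word_appears (hF f Ff) fx.
  (* For [B] at least [|g| + psize f], the occurrence of [f] lies wholly inside the word. *)
  have [B NB xB] := xP [seq g + m%:Z | m <- iota 0 (psize f)] (`|g| + psize f)%N.
  have [/asboolP avB uB sB _] := wuP B.
  have /negP[] := avB _ (ex_intro2 _ _ f Ff erefl).
  set w := (wu B).1 in xB sB *; set u := (wu B).2 in xB sB uB.
  set q := absz (u%:Z + g).
  have -> : pattern_word f = take (psize f) (drop q w).
    apply: (@eq_from_nth _ a0) => [|m].
      by rewrite fg size_map size_iota size_takel// size_drop; lia.
    rewrite fg size_map size_iota => mf.
    rewrite (nth_map 0%N) ?size_iota// nth_iota// add0n nth_take// nth_drop.
    rewrite -xB; last by apply/mapP; exists m; rewrite // mem_iota.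
    by congr nth; lia.
  rewrite -{2}(cat_take_drop q w) -{2}(cat_take_drop (psize f) (drop q w)).
  exact: infix_infix.
have [B _ xB] := xP [seq (s i)%:Z | i <- enum I] 0%N.
have [_ _ _ /negP[]] := wuP B.
apply/traces_in; exists x => // i; rewrite ffunE -xB//.
by apply/mapP; exists i; rewrite ?mem_enum.
Qed.

(** * Lower bound for the number of traces *)

(** If [b > g], Bernoulli's inequality makes [(b / g) ^+ n] exceed any constant. *)
Lemma exprn_le_bounded (R : realType) (b g c : R) : 0 <= b -> 0 < g ->
  (forall n, b ^+ n <= g ^+ n * c) -> b <= g.
Proof.
move=> b0 g0 bgc; rewrite leNgt; apply/negP => gb.
pose e := b / g - 1.
have e0 : 0 < e by rewrite subr_gt0 ltr_pdivlMr// mul1r.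
have bern n : 1 + e *+ n <= (1 + e) ^+ n.
  elim: n => [|n IHn]; first by rewrite mulr0n addr0 expr0.
  rewrite exprSr (le_trans _ (ler_wpM2r _ IHn))//; last by rewrite ltW// ltr_wpDl// ltW.
  rewrite mulrDl mul1r mulrDr mulr1 mulrS.
  have : 0 <= e *+ n * e by rewrite mulr_ge0 ?mulrn_wge0 ?ltW.
  lra.
have /archi_boundP : 0 <= `|c| / e by rewrite divr_ge0// ltW.
set n := Num.bound _; rewrite ltr_pdivrMr// mulr_natl => cn.
have := bgc n; rewrite mulrC -ler_pdivrMr ?exprn_gt0// -expr_div_n.
rewrite (_ : b / g = 1 + e); last by rewrite /e addrC subrK.
move=> /(le_trans (bern n)); apply/negP; rewrite -ltNge.
by apply: (le_lt_trans (ler_norm c)); apply: (lt_trans cn); rewrite ltrDr.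
Qed.

Lemma card_traces_ge (R : realType) (A I : finType) (F : set (pattern A))
    (beta : R) (s : I -> nat) :
    (forall f, F f -> connected_pattern f) -> 0 < beta -> (0 < #|A|)%N ->
    (forall n, beta ^+ n <= #|language (@pattern_word A @` F) n|%:R) ->
    injective s ->
  beta ^+ #|I| <= #|traces (subshift F) (fun i => (s i)%:Z)|%:R.
Proof.
move=> hF b0 /card_gt0P[a0 _] Lge s_inj.
set W := @pattern_word A @` F in Lge; set G := #|traces _ _|.
have [B BP] := window_traces a0 s hF.
have G0 : (0 < G)%N.
  have : (0 < #|language W (B + B)|)%N.
    by rewrite -(ltr_nat R) (lt_le_trans _ (Lge _))// exprn_gt0.
  move=> /card_gt0P[w]; rewrite finset.inE => wW; apply/card_gt0P.
  by exists [ffun i => nth a0 w (B + s i)]; apply: BP; rewrite ?size_tuple.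
have [I0|I0] := posnP #|I|; first by rewrite I0 expr0 ler1n.
pose D := (\max_i s i)%N.
have sD i : (s i <= D)%N by exact: leq_bigmax.
pose K := #|{ffun I -> A}|.
have K0 : (0 < K)%N by apply/card_gt0P; exists [ffun=> a0].
(* The translate by [t - D] starts less than [B] from an end of the word or outside it, so
   [window_traces] does not apply. *)
pose outer t N := ((t < D + B) || (N + D < t + B))%N.
(* There are [N + D] translates, hence the extra [G ^ D]; at most [D + B + B] of them are outer,
   each costing a factor at most [K]. *)
apply: (@exprn_le_bounded _ _ _ (G%:R ^+ D * K%:R ^+ (D + B + B))).
- by rewrite exprn_ge0// ltW.
- by rewrite ltr0n.
move=> N; pose J := 'I_(N + D).
(* [T t] is the range of [s] translated by [t - D]. *)
pose T (t : J) : pred nat := fun j => [exists i, s i + t == j + D]%N.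
have coverT j : (j < N)%N -> #|[pred t | T t j]| = #|I|.
  move=> jN; have lt i : (j + D - s i < N + D)%N by lia.
  rewrite -(@card_imset _ _ (fun i => Ordinal (lt i))) => [|i i' /(congr1 val)/= e].
    apply: eq_card => t; rewrite inE; apply/existsP/imsetP => -[i].
      by move=> /eqP e; exists i => //; apply: val_inj => /=; lia.
    by move=> _ ->; exists i => /=; have := sD i; lia.
  by apply: s_inj; have := sD i; have := sD i'; lia.
have := shearer R (language W N) I0 coverT.
(* A window may read arbitrary values beyond the word, through truncated subtraction or [a0];
   [spread] keeps only the positions below [N], so the masked word is a function of the window. *)
pose window (t : J) (w : N.-tuple A) := [ffun i => nth a0 w (t + s i - D)].
pose spread (t : J) (p : {ffun I -> A}) : N.-tuple (option A) :=
  [tuple if [pick i | s i + t == j + D]%N is Some i then Some (p i) else None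
     | j < N].
have maskedE t w : masked (T t) w = spread t (window t w).
  apply: eq_from_tnth => j; rewrite !tnth_mktuple.
  case: pickP => [i /eqP ij|noi]; last by rewrite ifN//; apply/existsP => -[i]; rewrite noi.
  rewrite ifT; last by apply/existsP; exists i; apply/eqP.
  by rewrite ffunE (tnth_nth a0); congr (Some (nth _ _ _)); lia.
have proj_le t (P : {set {ffun I -> A}}) :
    (forall w, w \in language W N -> window t w \in P) ->
    (#|masked (T t) @: language W N| <= #|P|)%N.
  move=> wP; rewrite (leq_trans _ (leq_imset_card (spread t) _))//.
  apply/subset_leq_card/fintype.subsetP => _ /imsetP[w wL ->].
  by rewrite maskedE imset_f// wP.
have projG t : (#|masked (T t) @: language W N| <= G * K ^ outer t N)%N.
  have [out|] := boolP (outer t N).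
    rewrite expn1 (@leq_trans K)//; last by rewrite leq_pmull.
    by rewrite /K -(@cardsT {ffun I -> A}); apply: proj_le => w _; rewrite finset.inE.
  rewrite negb_or -!leqNgt => /andP[t1 t2]; rewrite expn0 muln1.
  apply: proj_le => w; rewrite finset.inE => wW.
  rewrite (_ : window t w = [ffun i => nth a0 w (t - D + s i)]).
    by apply: BP; rewrite ?size_tuple//; lia.
  by apply/ffunP => i; rewrite !ffunE; congr nth; have := sD i; lia.
have card_outer : (\sum_(t : J) outer t N <= D + B + B)%N.
  rewrite -big_mkcond/= sum1_card cardE -(size_map val).
  rewrite -[leqRHS](_ : size (iota 0 (D + B) ++ iota (N + D - B).+1 B) = _).
    apply: uniq_leq_size => [|_ /mapP[t + ->]].
      by rewrite (map_inj_uniq val_inj) enum_uniq.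
    rewrite mem_enum mem_cat !mem_iota/= => out; have {}out : outer t N := out.
    by have := ltn_ord t; rewrite /outer in out *; lia.
  by rewrite size_cat !size_iota.
rewrite -exprM mulnC exprM => shearerL.
apply: (@le_trans _ _ (#|language W N|%:R ^+ #|I|)).
  by apply: lerXn2r; rewrite ?nnegrE ?exprn_ge0// ltW.
apply: (le_trans shearerL).
rewrite -!natrX -!natrM -natr_prod ler_nat.
apply: (leq_trans (leq_prod (fun t _ => projG t))).
rewrite big_split/= prod_nat_const card_ord expnD -mulnA leq_mul2l.
rewrite -expn_sum leq_mul2l (@leq_pexp2l K)// ?orbT//.
Qed.

(** * Fekete's lemma *)

(** The limit is the infimum: take [k] with [a k / k] near it and divide [n] by [k]; the remainder
    contributes a bounded amount, negligible after division by [n]. *)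
Lemma fekete (R : realType) (a : nat -> R) :
    (forall n, 0 <= a n) -> (forall m n, a (m + n)%N <= a m + a n) ->
  cvgn (fun n => a n / n%:R).
Proof.
move=> a0 aD; pose E := [set a n / n%:R | n in [set n | (0 < n)%N]].
have aM k q r : a (q * k + r)%N <= a k *+ q + a r.
  elim: q => [|q IHq]; first by rewrite mul0n add0n mulr0n add0r.
  by rewrite mulSn -addnA mulrS -addrA (le_trans (aD _ _))// lerD2l.
have infE : has_inf E.
  split; first by exists (a 1 / 1%:R), 1%N.
  by exists 0 => _ [n _ <-]; rewrite divr_ge0.
apply/cvg_ex; exists (inf E); apply/cvgrPdist_le => e e0.
have e2 : 0 < e / 2 by rewrite divr_gt0.
have [_ [k k0 <-] ak] := inf_adherent e2 infE.
(* [c] bounds [a r] for all [r <= k], by splitting [r] into ones. *)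
rewrite /= in k0; set c := a 0%N + a 1%N *+ k.
have c0 : 0 <= c by rewrite addr_ge0 ?mulrn_wge0.
have ar r : (r <= k)%N -> a r <= c.
  move=> rk; have := aM 1%N r 0%N; rewrite muln1 addn0 addrC => /le_trans; apply.
  by rewrite lerD2l ler_wpMn2l.
have ce : 0 <= c / (e / 2) by rewrite divr_ge0// ltW.
near=> n.
have n0 : (0 < n)%N by near: n; exact: nbhs_infty_gt.
have nR : 0 < n%:R :> R by rewrite ltr0n.
have kR : 0 < k%:R :> R by rewrite ltr0n.
have cn : c / (e / 2) <= n%:R by near: n; exact: nbhs_infty_ger.
have infn : inf E <= a n / n%:R.
  by apply: ge_inf; [exact: infE.2|exists n].
rewrite distrC ger0_norm ?subr_ge0// lerBlDl.
have -> : inf E + e = (inf E + e / 2) + e / 2 by lra.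
apply: (@le_trans _ _ (a k / k%:R + c / n%:R)); last first.
  apply: lerD; first exact: ltW.
  by rewrite ler_pdivrMr// mulrC -ler_pdivrMr.
rewrite ler_pdivrMr// mulrDl divfK ?gt_eqF//.
rewrite {1}(divn_eq n k) (le_trans (aM _ _ _))// lerD ?ar//; last first.
  by rewrite ltnW// ltn_mod.
rewrite mulrAC ler_pdivlMr// -[a k *+ _]mulr_natr -mulrA ler_wpM2l//.
by rewrite -natrM ler_nat leq_trunc_div.
Unshelve. all: by end_near. Qed.

(** * Integer positions and submultiplicativity of both counts *)

Lemma fset_int_bounded (S : {fset int}) :
  exists M : nat, forall k, k \in S -> (`|k| <= M)%N.
Proof. by exists (\max_(k <- S) `|k|)%N => k kS; exact: leq_bigmax_seq. Qed.

Lemma card_traces_int_ge (R : realType) (A I : finType) (F : set (pattern A))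
    (beta : R) (s : I -> int) :
    (forall f, F f -> connected_pattern f) -> 0 < beta ->
    (beta%:E <= (#|A|%:R)%:E
      - \esum_(f in F) (beta ^ (1 - (psize f)%:Z))%:E)%E ->
    injective s ->
  beta ^+ #|I| <= #|traces (subshift F) s|%:R.
Proof.
move=> hF b0 hsum s_inj; have Wsum := sum_forbidden_le b0 hsum.
have A0 : (0 < #|A|)%N.
  have := Wsum 0%N; rewrite big_ord0 subr_ge0 => /(lt_le_trans b0).
  by rewrite ltr0n.
have W0 : ~ (@pattern_word A @` F) [::].
  move=> [f _ /(congr1 size)]; rewrite size_pattern_word => f0.
  by have := psize_gt0 f; rewrite f0.
(* Translating by [M] makes all positions natural numbers, as [card_traces_ge] requires. *)
pose M := (\max_i `|s i|)%N.
pose r i : nat := absz (M%:Z + s i).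
have rE i : (r i)%:Z = M%:Z + s i.
  have := @leq_bigmax _ (fun i => `|s i|%N) i; rewrite -/M /r; lia.
rewrite -(traces_shift F M%:Z).
have -> : (fun i => M%:Z + s i) = (fun i => (r i)%:Z).
  by apply/funext => i; rewrite rE.
apply: card_traces_ge => //; first exact: language_growth.
by move=> k l /(congr1 Posz); rewrite !rE => /addrI; exact: s_inj.
Qed.

Lemma min_admissibleP (A : finType) (F : set (pattern A)) (n : nat) :
  exists2 S : {fset int}, #|` S| = n &
    #|globally_admissible F S| = min_admissible F n.
Proof. by rewrite /min_admissible; case: ex_minnP => m /asboolP. Qed.

Lemma min_admissible_le (A : finType) (F : set (pattern A)) (S : {fset int}) :
  (min_admissible F #|` S| <= #|globally_admissible F S|)%N.
Proof.
by rewrite /min_admissible; case: ex_minnP => m _; apply; apply/asboolP; exists S.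
Qed.

Lemma min_admissibleD (A : finType) (F : set (pattern A)) (m n : nat) :
  (min_admissible F (m + n) <= min_admissible F m * min_admissible F n)%N.
Proof.
have [S Sm <-] := min_admissibleP F m; have [T Tn <-] := min_admissibleP F n.
have [M SM] := fset_int_bounded S; have [N TN] := fset_int_bounded T.
(* This shift moves a minimiser [T] to the right of [S], so that the union has exactly [m + n]
   elements. *)
pose g : int := (M + N).+1%:Z.
pose T' := [fset (g + k)%R | k in T]%fset.
have ST' : [disjoint S & T']%fset.
  apply/fdisjointP => k kS; apply/negP => /imfsetP[l /= lT kl].
  by have := SM _ kS; have := TN _ lT; rewrite kl /g; lia.
have -> : (m + n)%N = #|` S `|` T'|%fset.
  rewrite cardfsU (eqP ST') cardfs0 subn0 Sm -Tn.
  by rewrite card_imfset//; exact: addrI.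
rewrite (leq_trans (min_admissible_le _ _))// !globally_admissibleE.
rewrite -(traces_shift F g (val : T -> int)).
rewrite (leq_trans _ (card_traces_sum _ _ _))//.
apply: card_traces_le => -[k kST] /=.
have := kST; rewrite in_fsetU => /orP[kS|/imfsetP[l /= lT kl]].
  by exists (inl [` kS]%fset).
by exists (inr [` lT]%fset).
Qed.

(** Intervals of every length are counted, since Fekete's lemma needs all [n], while centered
    intervals have only odd lengths. *)
Definition interval_traces (A : finType) (F : set (pattern A)) (n : nat) : nat :=
  #|traces (subshift F) (fun i : 'I_n => i%:Z)|.

Lemma interval_tracesD (A : finType) (F : set (pattern A)) (m n : nat) :
  (interval_traces F (m + n) <= interval_traces F m * interval_traces F n)%N.
Proof.
rewrite /interval_traces -(traces_shift F m%:Z (fun i : 'I_n => i%:Z)).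
rewrite (leq_trans _ (card_traces_sum _ _ _))//.
apply: card_traces_le => i; exists (fintype.split i).
by case: fintype.split_ordP => j ->.
Qed.

Lemma mem_centered_interval (n : nat) (k : int) :
  (k \in centered_interval n) = (`|k| <= n)%N.
Proof.
apply/imfsetP/idP => [[i + ->]|kn]; first by rewrite [i \in _]mem_iota; lia.
exists (absz (k + n%:Z)); last by lia.
by rewrite [(_ \in _)]mem_iota; lia.
Qed.

Lemma card_centered_interval (n : nat) : #|` centered_interval n| = (2 * n).+1.
Proof.
rewrite card_imfset => [|i j /addIr[]//].
rewrite -[RHS](size_iota 0 (2 * n).+1); apply/perm_size/uniq_perm.
- exact: enum_finmem_uniq.
- exact: iota_uniq.
- exact: enum_finmemE.
Qed.

Lemma card_admissible_centered (A : finType) (F : set (pattern A)) (n : nat) :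
  #|globally_admissible F (centered_interval n)| = interval_traces F (2 * n).+1.
Proof.
rewrite globally_admissibleE /interval_traces.
rewrite -(traces_shift F (- n%:Z) (fun i : 'I_(2 * n).+1 => i%:Z)).
apply/eqP; rewrite eqn_leq; apply/andP; split; apply: card_traces_le.
  move=> [k /= kn]; have := kn; rewrite mem_centered_interval => kn'.
  have lt : (absz (k + n%:Z)%R < (2 * n).+1)%N by lia.
  by exists (Ordinal lt) => /=; lia.
move=> i; have iC : - n%:Z + i%:Z \in centered_interval n.
  by rewrite mem_centered_interval; have := ltn_ord i; lia.
by exists [` iC]%fset.
Qed.

(** * Existence of the limits and conclusion *)

(** The bound forces [u n >= 1], so the logarithms are nonnegative and subadditive; the lower bound
    then passes to the limit. *)
Lemma submultiplicative_cvg (R : realType) (u : nat -> nat) (beta : R) :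
    0 < beta -> (forall n, beta ^+ n <= (u n)%:R) ->
    (forall m n, u (m + n) <= u m * u n)%N ->
  exists2 l, ln beta <= l & (ln ((u n)%:R : R) / n%:R) @[n --> \oo] --> l.
Proof.
move=> b0 ub uD.
have u0 n : (0 < u n)%N by rewrite -(ltr_nat R) (lt_le_trans _ (ub n))// exprn_gt0.
have cv : cvgn (fun n => ln ((u n)%:R : R) / n%:R).
  apply: (@fekete _ (fun n => ln (u n)%:R)) => [n|m n].
    by rewrite ln_ge0// ler1n.
  by rewrite -lnM ?posrE ?ltr0n// ler_ln ?posrE -?natrM ?ltr0n ?muln_gt0 ?u0// ler_nat.
exists (limn (fun n => ln ((u n)%:R : R) / n%:R)); last exact: cv.
apply: limr_ge => //; near=> n.
have n0 : (0 < n)%N by near: n; exact: nbhs_infty_gt.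
rewrite ler_pdivlMr ?ltr0n// mulr_natr -lnXn// ler_ln ?posrE ?exprn_gt0//.
by rewrite ltr0n.
Unshelve. all: by end_near. Qed.

Theorem corollary19 (R : realType) (A : finType) (F : set (pattern A))
    (hF : forall f, F f -> connected_pattern f)
    (beta : R) (hbeta : 0 < beta)
    (hsum : (beta%:E <= (#|A|%:R)%:E
              - \esum_(f in F) (beta ^ (1 - (psize f)%:Z))%:E)%E) :
  [/\ cvgn (growth_seq R F), beta <= growth R F,
      cvgn (entropy_seq R F) & ((ln beta)%:E <= entropy R F)%E].
Proof.
have mge n : beta ^+ n <= (min_admissible F n)%:R.
  have [S <- <-] := min_admissibleP F n; rewrite globally_admissibleE cardfE.
  by apply: card_traces_int_ge => //; exact: val_inj.
have [l bl ml] := submultiplicative_cvg hbeta mge (min_admissibleD F).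
have ige n : beta ^+ n <= (interval_traces F n)%:R.
  rewrite -[n in leLHS]card_ord; apply: card_traces_int_ge => // i j [].
  exact: val_inj.
have [h bh ih] := submultiplicative_cvg hbeta ige (interval_tracesD F).
(* Positivity of the counts lets the real power be written as [expR] of the normalised logarithm. *)
have gl : growth_seq R F @ \oo --> expR l.
  have -> : growth_seq R F = expR \o (fun n => ln ((min_admissible F n)%:R : R) / n%:R).
    apply/funext => n; rewrite /growth_seq /powR ifF /= 1?mulrC//.
    by rewrite gt_eqF// (lt_le_trans _ (mge n))// exprn_gt0.
  by apply: continuous_cvg => //; exact: continuous_expR.
(* The entropy sequence is the subsequence of interval counts at lengths [2 * n + 1]; positivity
   keeps the extended logarithm finite. *)
have eh : entropy_seq R F @ \oo --> h%:E.
  have -> : entropy_seq R F = (fun n =>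
      (ln ((interval_traces F (2 * n).+1)%:R : R) / (2 * n).+1%:R)%:E).
    apply/funext => n; rewrite /entropy_seq card_centered_interval.
    rewrite card_admissible_centered lne_EFin//.
    by rewrite (lt_le_trans _ (ige _))// exprn_gt0.
  have twoS : (2 * n).+1 @[n --> \oo] --> \oo.
    by move=> P [N _ NP]; exists N => // n Nn; apply: NP => /=; move: Nn => /=; lia.
  apply: cvg_EFin; first by near=> n.
  exact: cvg_comp twoS ih.
split.
- by apply/cvg_ex; exists (expR l).
- by rewrite /growth (cvg_lim _ gl)// -[leLHS]lnK ?posrE// ler_expR.
- by apply/cvg_ex; exists h%:E.
- by rewrite /entropy (cvg_lim _ eh)// lee_fin.
Unshelve. all: by end_near. Qed.
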